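(* When $\eta=0$, the DDIM update $$\tilde x_{k-1}=\sqrt{\bar a_{k-1}}\,\widehat{\tilde x}_0(\tilde x_k,k)+\sqrt{1-\bar a_{k-1}}\,\epsilon_\theta(\tilde x_k,k),\qquad \widehat{\tilde x}_0(\tilde x_k,k):=\frac{\tilde x_k-\sqrt{1-\bar a_k}\,\epsilon_\theta(\tilde x_k,k)}{\sqrt{\bar a_k}},$$ is exactly the first-order one-step discretization of the learned reverse ODE $$\frac{\mathrm{d}X_t}{\mathrm{d}t}=f_tX_t+\frac{g_t^2}{2\sigma_t}\epsilon_\theta(X_t,t)$$ obtained by freezing $\epsilon_\theta$ on the interval $[t_{k-1},t_k]$; that is, it equals $$\frac{\alpha_{t_{k-1}}}{\alpha_{t_k}}\tilde x_k-\alpha_{t_{k-1}}\,\epsilon_\theta(\tilde x_k,k)\int_{\lambda_{t_k}}^{\lambda_{t_{k-1}}}e^{-\zeta}\,\mathrm{d}\zeta .$$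
   Context: Discrete schedule: grid $0=t_0<\cdots<t_N=1$, $b_k\in(0,1)$, $a_k:=1-b_k$, $\bar a_k:=\prod_{i=1}^ka_i$, $\bar a_0:=1$. Continuous schedule: differentiable $\alpha_t,\sigma_t\geq 0$ on $[0,1]$ with $\alpha_t^2+\sigma_t^2=1$, $\alpha_t>0$, $\alpha_{t_k}=\sqrt{\bar a_k}$, $\sigma_{t_k}=\sqrt{1-\bar a_k}$, and $\sigma_t>0$ for $t>0$; $f_t:=\dot\alpha_t/\alpha_t$, $g_t^2:=\frac{\mathrm{d}}{\mathrm{d}t}\sigma_t^2-2f_t\sigma_t^2\ge0$; $\lambda_t:=\log(\alpha_t/\sigma_t)$, assumed monotone in $t$, with $\lambda_0=+\infty$ and $e^{-\lambda_0}=0$. $\epsilon_\theta(x,t)$ is a given $\mathbb{R}^d$-valued function and $\epsilon_\theta(x,k):=\epsilon_\theta(x,t_k)$. The general DDIM family with parameter $\eta\in[0,1]$ is $\tilde x_{k-1}=\sqrt{\bar a_{k-1}}\,\widehat{\tilde x}_0+\sqrt{1-\bar a_{k-1}-\widehat s_k^2}\,\epsilon_\theta(\tilde x_k,k)+\widehat s_kz_k$ with $z_k\sim\mathcal{N}(0,I)$ and $\widehat s_k=\eta\sqrt{\frac{1-\bar a_{k-1}}{1-\bar a_k}(1-\frac{\bar a_k}{\bar a_{k-1}})}$; $\eta=0$ gives the deterministic update in the claim. Freezing: solutions of the learned reverse ODE satisfy $X_t=\frac{\alpha_t}{\alpha_s}X_s-\alpha_t\int_{\lambda_s}^{\lambda_t}e^{-\zeta}\epsilon_\theta(X_{\vartheta(\zeta)},\vartheta(\zeta))\,\mathrm{d}\zeta$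 where $\vartheta$ is the inverse of $t\mapsto\lambda_t$. The first-order one-step discretization obtained by freezing takes $s=t_k$, $t=t_{k-1}$, $X_{t_k}=\tilde x_k$, and replaces $\epsilon_\theta(X_{\vartheta(\zeta)},\vartheta(\zeta))$ by the constant $\epsilon_\theta(\tilde x_k,k)$. *)

(* Defs.v *)
From HB Require Import structures.
From mathcomp Require Import all_boot all_order all_algebra.
From mathcomp Require Import all_classical all_reals all_analysis.
Set Implicit Arguments.
Unset Strict Implicit.
Unset Printing Implicit Defensive.
Import Order.TTheory GRing.Theory Num.Theory.
Import numFieldNormedType.Exports.
Local Open Scope classical_set_scope.
Local Open Scope ring_scope.

Section Schedules.
Context {R : realType}.

Record discrete_schedule (N : nat) (tau b : nat -> R) : Prop := {
  grid0 : tau 0%N = 0;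
  gridN : tau N = 1;
  grid_lt : forall i, (i < N)%N -> tau i < tau i.+1;
  rate_itv : forall k, (1 <= k <= N)%N -> 0 < b k < 1
}.

Definition abar (b : nat -> R) (k : nat) : R :=
  \prod_(1 <= i < k.+1) (1 - b i).

Definition f_coef (alpha : R -> R) (t : R) : R := derive1 alpha t / alpha t.

(* This is g_t ^ 2; the square root g_t itself is never needed. *)
Definition g2_coef (alpha sigma : R -> R) (t : R) : R :=
  derive1 (fun u => sigma u ^+ 2) t - 2 * f_coef alpha t * sigma t ^+ 2.

(* The value at sigma t = 0 is the convention lambda_0 = +oo. *)
Definition lambda (alpha sigma : R -> R) (t : R) : \bar R :=
  if sigma t == 0 then +oo%E else (ln (alpha t / sigma t))%:E.

(* The schedules are functions on [0, 1], represented by functions on R that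
   are differentiable at the points of [0, 1]. Nothing is assumed about their
   values elsewhere, and a function with one-sided derivatives at 0 and 1
   extends affinely to such a function with the same derivatives on [0, 1]. *)
Record continuous_schedule (N : nat) (tau b : nat -> R)
    (alpha sigma : R -> R) : Prop := {
  alpha_derivable : forall t, 0 <= t <= 1 -> derivable alpha t 1;
  sigma_derivable : forall t, 0 <= t <= 1 -> derivable sigma t 1;
  alpha_gt0 : forall t, 0 <= t <= 1 -> 0 < alpha t;
  sigma_ge0 : forall t, 0 <= t <= 1 -> 0 <= sigma t;
  sigma_gt0 : forall t, 0 < t <= 1 -> 0 < sigma t;
  variance_preserving : forall t, 0 <= t <= 1 ->
    alpha t ^+ 2 + sigma t ^+ 2 = 1;
  alpha_grid : forall k, (k <= N)%N -> alpha (tau k) = Num.sqrt (abar b k);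
  sigma_grid : forall k, (k <= N)%N ->
    sigma (tau k) = Num.sqrt (1 - abar b k);
  g2_ge0 : forall t, 0 <= t <= 1 -> 0 <= g2_coef alpha sigma t;
  lambda_monotone :
    (forall s t, 0 <= s -> s <= t -> t <= 1 ->
       (lambda alpha sigma s <= lambda alpha sigma t)%E) \/
    (forall s t, 0 <= s -> s <= t -> t <= 1 ->
       (lambda alpha sigma t <= lambda alpha sigma s)%E)
}.

End Schedules.

Section DDIM.
Context {R : realType} {d : nat}.
Variables (tau b : nat -> R) (eps : 'rV[R]_d -> R -> 'rV[R]_d).

Definition ddim_x0 (k : nat) (x : 'rV[R]_d) : 'rV[R]_d :=
  (Num.sqrt (abar b k))^-1 *: (x - Num.sqrt (1 - abar b k) *: eps x (tau k)).

Definition ddim_std (eta : R) (k : nat) : R :=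
  eta * Num.sqrt ((1 - abar b k.-1) / (1 - abar b k) *
                  (1 - abar b k / abar b k.-1)).

(* z is a realization of the Gaussian noise z_k. *)
Definition ddim_step (eta : R) (k : nat) (x z : 'rV[R]_d) : 'rV[R]_d :=
  Num.sqrt (abar b k.-1) *: ddim_x0 k x
  + Num.sqrt (1 - abar b k.-1 - ddim_std eta k ^+ 2) *: eps x (tau k)
  + ddim_std eta k *: z.

End DDIM.

Section ReverseODE.
Context {R : realType} {d : nat}.

(* The integral from l to m; the bounds may be infinite, and the sign changes
   when m < l. *)
Definition oriented_integral (l m : \bar R) (h : R -> R) : R :=
  if (l <= m)%E
  then \int[lebesgue_measure]_(z in [set z : R | (l <= z%:E <= m)%E]) h z
  else - \int[lebesgue_measure]_(z in [set z : R | (m <= z%:E <= l)%E]) h z.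

Definition reverse_drift (alpha sigma : R -> R)
    (eps : 'rV[R]_d -> R -> 'rV[R]_d) (x : 'rV[R]_d) (t : R) : 'rV[R]_d :=
  f_coef alpha t *: x + (g2_coef alpha sigma t / (2 * sigma t)) *: eps x t.

(* The equation is required in the open interval only: the drift divides by
   sigma, which vanishes at time 0. *)
Definition solves_reverse_ode (alpha sigma : R -> R)
    (eps : 'rV[R]_d -> R -> 'rV[R]_d) (t0 t1 : R) (X : R -> 'rV[R]_d) : Prop :=
  {within `[t0, t1], continuous X} /\
  forall t, t0 < t < t1 ->
    is_derive t 1 X (reverse_drift alpha sigma eps (X t) t).

Definition freeze (eps : 'rV[R]_d -> R -> 'rV[R]_d) (x : 'rV[R]_d) (s : R) :
    'rV[R]_d -> R -> 'rV[R]_d := fun _ _ => eps x s.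

(* Started from x at time s, the equation whose eps is frozen at (x, s) has a
   solution back to time t < s, and every such solution takes the value y
   at t. *)
Definition frozen_ode_step (alpha sigma : R -> R)
    (eps : 'rV[R]_d -> R -> 'rV[R]_d) (s t : R) (x y : 'rV[R]_d) : Prop :=
  (exists X, solves_reverse_ode alpha sigma (freeze eps x s) t s X /\ X s = x)
  /\ forall X, solves_reverse_ode alpha sigma (freeze eps x s) t s X ->
       X s = x -> X t = y.

(* Right-hand side of the variation-of-constants formula in the variable
   zeta = lambda_t. A solution X of the reverse ODE satisfies
   X t = variation_of_constants alpha sigma s t (X s) e, where
   e zeta = eps (X (theta zeta)) (theta zeta) and theta inverts lambda. *)
Definition variation_of_constants (alpha sigma : R -> R) (s t : R)
    (x : 'rV[R]_d) (e : R -> 'rV[R]_d) : 'rV[R]_d :=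
  (alpha t / alpha s) *: x
  - alpha t *: \row_j oriented_integral
      (lambda alpha sigma s) (lambda alpha sigma t)
      (fun z => expR (- z) * e z 0 j).

Definition frozen_step (alpha sigma : R -> R)
    (eps : 'rV[R]_d -> R -> 'rV[R]_d) (s t : R) (x : 'rV[R]_d) : 'rV[R]_d :=
  variation_of_constants alpha sigma s t x (fun=> eps x s).

End ReverseODE.

(* Main.v *)
Require Import Defs.
From HB Require Import structures.
From mathcomp Require Import all_boot all_order all_algebra.
From mathcomp Require Import all_classical all_reals all_analysis.
From mathcomp Require Import measurable_realfun ring lra.
Import Order.TTheory GRing.Theory Num.Theory.
Import numFieldNormedType.Exports.
Local Open Scope classical_set_scope.
Local Open Scope ring_scope.

(** With [e] frozen, [sigma * e] is a particular solution of the reverse ODE,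
    because [g^2 / (2 sigma) = sigma' - f sigma], and [alpha] solves the
    homogeneous equation. Hence [(X - sigma e) / alpha] is constant along
    solutions, which is the DDIM update. In the variable [lambda],
    [exp (- lambda) = sigma / alpha], so the integral of [exp (- zeta)] is the
    increment of [sigma / alpha]; this still holds at [lambda_0 = +oo]. *)

(** Reduces the vector-valued ODE to scalar calculus: one direction assembles the explicit solution
    from its coordinates, the other extracts the coordinates of an arbitrary solution. *)
Lemma is_derive_mx (R : realFieldType) (V : normedModType R) (m n : nat)
    (M : V -> 'M[R]_(m, n)) (D : 'M[R]_(m, n)) (t v : V) :
  is_derive t v M D <-> forall i j, is_derive t v (fun u => M u i j) (D i j).
Proof.
split=> [[dM <-] i j|dM].
  apply: DeriveDef; first by move/derivable_mxP : dM.
  by rewrite derive_mx// mxE.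
have dM' : derivable M t v by apply/derivable_mxP => i j; case: (dM i j).
apply: DeriveDef => //; rewrite derive_mx//.
by apply/matrixP => i j; rewrite mxE; case: (dM i j).
Qed.

(** Mean value theorem. The derivative is asked for in the open interval only, to match
    [solves_reverse_ode], which gives mere continuity at the endpoints. *)
Lemma derive0_cst_itv (R : realType) (f : R -> R) (a b : R) : a <= b ->
  {within `[a, b], continuous f} ->
  (forall x, a < x < b -> is_derive x 1 f 0) -> f a = f b.
Proof.
move=> ab cf df; apply/eqP; rewrite eq_sym -subr_eq0; apply/eqP.
have df0 x : x \in `]a, b[ -> is_derive x 1 f (cst 0 x).
  by rewrite in_itv; exact: df.
by have [c _ ->] := MVT_segment ab df0 cf; rewrite mul0r.
Qed.

(** * Integrals of the decaying exponential up to a possibly infinite bound *)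

Section expRN.
Context {R : realType}.
Local Notation mu := (@lebesgue_measure R).

Lemma is_derive_NexpRN (z : R) :
  is_derive z 1 (fun x : R => - expR (- x)) (expR (- z)).
Proof.
have dN : is_derive z 1 (fun x : R => - x) (-1) by apply: is_deriveNid.
have de := is_derive_expR (- z).
have := @is_deriveN _ _ _ _ _ _ _ (is_derive1_comp de dN).
by move=> H; apply: is_derive_eq; rewrite /= mulrN1 opprK.
Qed.

(** The antiderivative is [- expR (- z)]. For [m = +oo] it tends to 0, in agreement with
    [expeR -oo = 0]. *)
Lemma integral_expRN (l : R) (m : \bar R) : (l%:E < m)%E ->
  (\int[mu]_(z in [set z : R | l%:E <= z%:E <= m]) (expR (- z))%:E =
   (expR (- l))%:E - expeR (- m))%E.
Proof.
have cN : continuous (fun x : R => expR (- x)).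
  move=> z; apply: continuous_comp; first exact: opp_continuous.
  exact: continuous_expR.
have cF : continuous (fun x : R => - expR (- x)).
  by move=> z; apply: (@cvgN _ _ _ _ _ (fun x => expR (- x))); exact: cN.
have dF z : derive1 (fun x : R => - expR (- x)) z = expR (- z).
  by rewrite derive1E; have [_ ->] := is_derive_NexpRN z.
case: m => [m| |//] lm.
- rewrite lte_fin in lm.
  rewrite (_ : [set z | _] = `[l, m]%classic); last first.
    by apply/seteqP; split => z /=; rewrite in_itv/= !lee_fin.
  rewrite (@continuous_FTC2 _ _ (fun x => - expR (- x)))//=.
  + by rewrite -!EFinB opprK addrC.
  + exact/continuous_subspaceT.
  + split; first by move=> z _; case: (is_derive_NexpRN z).
    * exact/cvg_at_right_filter/cF.
    * exact/cvg_at_left_filter/cF.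
- rewrite (_ : [set z | _] = `[l, +oo[%classic); last first.
    by apply/seteqP; split => z /=; rewrite in_itv/= leey lee_fin.
  rewrite (@ge0_continuous_FTC2y _ _ (fun x => - expR (- x)) _ 0)//=.
  + by rewrite -EFinB sub0r opprK sube0.
  + exact/continuous_subspaceT.
  + by rewrite -[X in _ --> X]oppr0; apply: cvgN; exact: cvgr_expR.
  + exact/cvg_at_right_filter/cF.
Qed.

(** The bound [l < m] selects the first branch of [oriented_integral] and excludes [m = -oo], so
    [expeR (- m)] is finite and [fine] loses nothing. *)
Lemma oriented_integral_expRN (l : R) (m : \bar R) (c : R) : (l%:E < m)%E ->
  oriented_integral l%:E m (fun z => expR (- z) * c) =
  (expR (- l) - fine (expeR (- m))) * c.
Proof.
move=> lm; rewrite /oriented_integral (ltW lm).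
have I := integral_expRN _ _ lm.
have fm : (expeR (- m) \is a fin_num)%E by case: m lm {I}.
have mD : measurable [set z : R | (l%:E <= z%:E <= m)%E].
  case: m lm {I fm} => [m| |//] lm.
    rewrite (_ : [set z | _] = `[l, m]%classic)//.
  rewrite (_ : [set z | _] = `[l, +oo[%classic)//.
  by apply/seteqP; split => z /=; rewrite in_itv/= leey lee_fin.
rewrite RintegralZr//.
  by rewrite /Rintegral I -(fineK fm) -EFinB.
(* The integrand is nonnegative, so the integral of its norm is the finite value [I] just
   computed. *)
apply/integrableP; split.
  apply/measurable_EFinP; apply: measurableT_comp => //.
under eq_integral do rewrite /= ger0_norm ?expR_ge0//.
by rewrite I -(fineK fm) -EFinB ltry.
Qed.

End expRN.

(** * Noise schedules and the reverse ODE with frozen noise prediction *)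

Section schedule.
Context {R : realType} {N : nat} {tau b : nat -> R} {alpha sigma : R -> R}.
Hypothesis Hdisc : discrete_schedule N tau b.
Hypothesis Hcont : continuous_schedule N tau b alpha sigma.

Lemma tau_itv k : (k <= N)%N -> 0 <= tau k <= 1.
Proof.
move=> kN.
have tau_mono i n : (i + n <= N)%N -> tau i <= tau (i + n)%N.
  elim: n => [|n IH]; first by rewrite addn0.
  rewrite addnS => inN; apply: (le_trans (IH (ltnW inN))).
  exact/ltW/(grid_lt Hdisc).
rewrite -{1}(grid0 Hdisc) -(gridN Hdisc); apply/andP; split.
  by rewrite -[k]add0n tau_mono.
by rewrite -{1}(subnKC kN) tau_mono// subnKC.
Qed.

Lemma abar_gt0 k : (k <= N)%N -> 0 < abar b k.
Proof.
elim: k => [|k IH] kN; first by rewrite /abar big_geq.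
rewrite /abar big_nat_recr//= mulr_gt0 ?IH//; first exact: ltnW.
by have := @rate_itv _ _ _ _ Hdisc k.+1 kN; lra.
Qed.

Lemma abar_lt k : (k < N)%N -> abar b k.+1 < abar b k.
Proof.
move=> kN; rewrite /abar big_nat_recr//= gtr_pMr; last exact/abar_gt0/ltnW.
by have := @rate_itv _ _ _ _ Hdisc k.+1 kN; lra.
Qed.

(** Where [sigma t = 0] both sides vanish, so the last denoising step, down to time 0, needs no
    separate treatment. *)
Lemma expeR_lambda t : 0 <= t <= 1 ->
  expeR (- lambda alpha sigma t) = (sigma t / alpha t)%:E.
Proof.
move=> t01; rewrite /lambda; case: eqP => [->|/eqP s0] /=; first by rewrite mul0r.
have st : 0 < sigma t by rewrite lt_def s0 (sigma_ge0 Hcont).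
have at0 := alpha_gt0 Hcont t01.
by rewrite expRN lnK ?invf_div// posrE divr_gt0.
Qed.

(** The derivative of [sigma ^+ 2] is twice [sigma] times that of [sigma]; dividing by [2 * sigma t]
    is legitimate away from time 0. *)
Lemma g2_coefE t : 0 < t <= 1 ->
  g2_coef alpha sigma t / (2 * sigma t) =
  'D_1 sigma t - f_coef alpha t * sigma t.
Proof.
move=> /andP[t0 t1]; have t01 : 0 <= t <= 1 by rewrite ltW.
have st0 : sigma t != 0 by rewrite gt_eqF// (sigma_gt0 Hcont)// t0.
have ds := sigma_derivable Hcont t01.
rewrite /g2_coef derive1E.
have -> : 'D_1 (fun u => sigma u ^+ 2) t = 2 * sigma t * 'D_1 sigma t.
  by rewrite (@deriveX _ _ sigma 2)//= /GRing.scale/= expr1.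
by field; rewrite st0.
Qed.

(** Existence comes from an explicit solution, uniqueness from a conserved quantity. The end time
    [t] may be 0, where the drift is singular; only continuity is used there. *)
Lemma frozen_ode_stepE (d : nat) (eps : 'rV[R]_d -> R -> 'rV[R]_d) (s t : R)
    (x : 'rV[R]_d) : 0 <= t -> t < s -> s <= 1 ->
  frozen_ode_step alpha sigma eps s t x
    (alpha t *: ((alpha s)^-1 *: (x - sigma s *: eps x s))
     + sigma t *: eps x s).
Proof.
move=> t0 ts s1; set e := eps x s; set c := (alpha s)^-1 *: (x - sigma s *: e).
have itvP u : t <= u <= s -> 0 <= u <= 1.
  by move=> /andP[tu us]; rewrite (le_trans t0 tu) (le_trans us).
have da u : t <= u <= s -> is_derive u 1 alpha ('D_1 alpha u).
  move=> /itvP u01; apply: DeriveDef => //.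
  exact: (alpha_derivable Hcont).
have ds u : t <= u <= s -> is_derive u 1 sigma ('D_1 sigma u).
  move=> /itvP u01; apply: DeriveDef => //.
  exact: (sigma_derivable Hcont).
have a_neq0 u : t <= u <= s -> alpha u != 0.
  by move=> /itvP u01; rewrite gt_eqF// (alpha_gt0 Hcont).
split.
  (* The coefficient [c] is the value of [(X - sigma e) / alpha] at [s] forced by [X s = x]. *)
  exists (fun u => alpha u *: c + sigma u *: e); split; last first.
    by rewrite /c scalerA divff ?a_neq0// ?lexx ?ltW// scale1r subrK.
  (* Stated on the closed interval, so that it also yields continuity at both endpoints. *)
  have dX u : t <= u <= s -> is_derive u 1 (fun v => alpha v *: c + sigma v *: e)
      ('D_1 alpha u *: c + 'D_1 sigma u *: e).
    move=> uts; apply/is_derive_mx => i j.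
    have -> : (fun v => (alpha v *: c + sigma v *: e) i j) =
        (c i j \*: alpha + e i j \*: sigma).
      by apply/funext => v; rewrite !mxE mulrC (mulrC (sigma v)).
    have H := is_deriveD (is_deriveZ (c i j) (da u uts))
                         (is_deriveZ (e i j) (ds u uts)).
    by apply: is_derive_eq; rewrite !mxE /GRing.scale/= mulrC (mulrC (e i j)).
  split=> [|u /andP[tu us]].
    apply: (@derivable_within_continuous _ _ _ `[t, s]) => u.
    by rewrite in_itv/= => /dX[].
  have uts : t <= u <= s by rewrite !ltW.
  have H := dX u uts; apply: is_derive_eq.
  rewrite /reverse_drift g2_coefE; last first.
    by rewrite (le_lt_trans t0 tu) (le_trans (ltW us)).
  apply/matrixP => i j; rewrite /freeze !mxE /f_coef derive1E -/e.
  by field; rewrite !a_neq0 ?lexx ?ltW.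
move=> X [cX dX] Xs.
apply/matrixP => i j; rewrite (ord1 i).
(* One coordinate of the conserved quantity; solving [Y t = Y s] for [X t] gives the claimed
   value. *)
pose Y u := (X u 0 j - sigma u * e 0 j) / alpha u.
suff : Y t = Y s.
  rewrite /Y Xs => /(congr1 (fun y => y * alpha t)).
  rewrite divfK ?a_neq0 ?lexx ?ltW// !mxE -/e => /eqP; rewrite subr_eq => /eqP ->.
  by field; rewrite !a_neq0 ?lexx ?ltW.
apply: derive0_cst_itv; first exact: ltW.
  have cXj : {within `[t, s], continuous (fun u => X u 0 j)}.
    move=> u; apply: (@continuous_comp (subspace `[t, s]) _ _ X
      (fun M : 'rV[R]_d => M 0 j)); first exact: cX.
    exact: coord_continuous.
  move=> u; apply: (@continuousM R (subspace `[t, s])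
    (fun u => X u 0 j - sigma u * e 0 j) (fun u => (alpha u)^-1)).
    apply: (@continuousB R _ (subspace `[t, s]) (fun u => X u 0 j)
      (fun u => sigma u * e 0 j)); first exact: cXj.
    apply: (@continuousM R (subspace `[t, s]) sigma (cst (e 0 j))).
      apply: (@derivable_within_continuous _ _ _ `[t, s]) => v.
      by rewrite in_itv/= => /ds[].
    exact: cst_continuous.
  apply: (@derivable_within_continuous _ _ _ `[t, s]) => v.
  rewrite in_itv/= => /andP[tv vs].
  have vts : t <= v <= s by rewrite tv.
  by apply: derivableV; [exact: a_neq0|case: (da v vts)].
move=> u uts.
have /andP[tu us] := uts.
have uts' : t <= u <= s by rewrite !ltW.
have dXj := (is_derive_mx _ _ _ _ _ _ _ _).1 (dX u uts) 0 j.
have au0 := a_neq0 _ uts'.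
have := is_deriveM (is_deriveB dXj (is_deriveZ (e 0 j) (ds u uts')))
                   (is_deriveV au0 (da u uts')).
rewrite (_ : _ * _ = Y); last first.
  by apply/funext => v; rewrite /Y /= [sigma v * _]mulrC.
move=> H; apply: is_derive_eq.
(* The numerator of [Y] has derivative [f_coef alpha u] times itself. Since this coefficient is the
   logarithmic derivative of [alpha], it cancels the term coming from the inverse of [alpha]. *)
rewrite /reverse_drift g2_coefE; last first.
  by rewrite (le_lt_trans t0 tu) (le_trans (ltW us)).
rewrite /freeze !mxE /f_coef derive1E.
rewrite -/e /GRing.scale/=.
rewrite [X in X * (- _ * _)](_ : _ = X u 0 j - e 0 j * sigma u)//.
by field.
Qed.
End schedule.


(** * Comparison on one grid interval *)

Theorem theorem7p8 (R : realType) (d N : nat) (tau b : nat -> R)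
    (alpha sigma : R -> R) (eps : 'rV[R]_d -> R -> 'rV[R]_d)
    (Hdisc : discrete_schedule N tau b)
    (Hcont : continuous_schedule N tau b alpha sigma)
    (k : nat) (Hk : (1 <= k <= N)%N) (x z : 'rV[R]_d) :
  let update := Num.sqrt (abar b k.-1) *: ddim_x0 tau b eps k x
                + Num.sqrt (1 - abar b k.-1) *: eps x (tau k) in
  [/\ ddim_step tau b eps 0 k x z = update,
      frozen_ode_step alpha sigma eps (tau k) (tau k.-1) x update,
      update = frozen_step alpha sigma eps (tau k) (tau k.-1) x
    & update =
        (alpha (tau k.-1) / alpha (tau k)) *: x
        - (alpha (tau k.-1) *
           oriented_integral (lambda alpha sigma (tau k))
             (lambda alpha sigma (tau k.-1)) (fun zeta => expR (- zeta)))
          *: eps x (tau k)].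
Proof.
(* From here [k.+1] is the current index and [k] the one being computed. *)
case: k Hk => [//|k] kN; rewrite succnK => update.
have [t01 s01] := (tau_itv Hdisc k (ltnW kN), tau_itv Hdisc k.+1 kN).
have ts := grid_lt Hdisc kN.
have s_gt0 : 0 < tau k.+1 by case/andP: t01 => t0 _; exact: le_lt_trans ts.
have at0 := alpha_gt0 Hcont t01.
have as0 := alpha_gt0 Hcont s01.
(* Only the starting time is sure to be positive: for [k = 0] the target is time 0, where [sigma]
   vanishes. *)
have ss0 : 0 < sigma (tau k.+1).
  by apply: (sigma_gt0 Hcont); rewrite s_gt0; case/andP: s01.
have updateE : update = alpha (tau k) *: ((alpha (tau k.+1))^-1 *:
    (x - sigma (tau k.+1) *: eps x (tau k.+1))) + sigma (tau k) *: eps x (tau k.+1).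
  by rewrite /update /ddim_x0 !(alpha_grid Hcont) ?(sigma_grid Hcont)// ltnW.
have lamE : lambda alpha sigma (tau k.+1) =
    (ln (alpha (tau k.+1) / sigma (tau k.+1)))%:E.
  by rewrite /lambda gt_eqF.
(* This fixes the orientation of the integral. Applying the exponential to the negated values
   reduces it to comparing [sigma / alpha] at the two times, and [abar] strictly decreases from [k]
   to [k.+1]. *)
have lam_lt : ((ln (alpha (tau k.+1) / sigma (tau k.+1)))%:E <
    lambda alpha sigma (tau k))%E.
  rewrite -lamE -lteN2 -lte_expeR !(expeR_lambda Hcont)// lte_fin.
  have [alt agt0] := (abar_lt Hdisc k kN, abar_gt0 Hdisc k (ltnW kN)).
  have s_lt : sigma (tau k) < sigma (tau k.+1).
    rewrite !(sigma_grid Hcont)//; last exact: ltnW.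
    (* The positivity of [1 - abar b k.+1] required by [ltr_sqrt] is read off from [ss0]. *)
    by rewrite ltr_sqrt ?ltrD2l ?ltrN2// -sqrtr_gt0 -(sigma_grid Hcont).
  have a_lt : alpha (tau k.+1) < alpha (tau k).
    by rewrite !(alpha_grid Hcont) ?ltr_sqrt// ltnW.
  rewrite (@lt_le_trans _ _ (sigma (tau k.+1) / alpha (tau k)))//.
    by rewrite ltr_pM2r// invr_gt0.
  by rewrite ler_pM2l// lef_pV2 ?posrE// ltW.
have intE c : oriented_integral (lambda alpha sigma (tau k.+1))
    (lambda alpha sigma (tau k)) (fun zeta => expR (- zeta) * c) =
    (sigma (tau k.+1) / alpha (tau k.+1) - sigma (tau k) / alpha (tau k)) * c.
  rewrite lamE oriented_integral_expRN// (expeR_lambda Hcont)//=.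
  by rewrite expRN lnK ?invf_div// posrE divr_gt0.
split.
- by rewrite /ddim_step /ddim_std mul0r expr0n/= subr0 scale0r addr0.
- rewrite updateE; apply: (frozen_ode_stepE Hcont) => //.
    by case/andP: t01.
  by case/andP: s01.
- rewrite updateE /frozen_step /variation_of_constants.
  apply/matrixP => i j; rewrite (ord1 i) !mxE intE.
  by field; rewrite !gt_eqF.
- rewrite updateE (_ : (fun zeta => _) = (fun zeta => expR (- zeta) * 1)).
    apply/matrixP => i j; rewrite !mxE intE.
    by field; rewrite !gt_eqF.
  by apply/funext => y; rewrite mulr1.
Qed.
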